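(* Let $\mathbf{L}\in\mathbb{R}^{N\times N}$ be an invertible symmetric matrix and let $\mathbf{C}_1,\dots,\mathbf{C}_m$ be selection matrices onto (possibly overlapping) subdomains $D_1,\dots,D_m$ such that each $\mathbf{C}_i\mathbf{L}\mathbf{C}_i^T$ is invertible. For each $\mathbf{b}\in\mathbb{R}^N$, let $\mathbf{x}^{(k)}$, $k\ge 0$, be the iterates of the symmetric multiplicative Vanka smoother applied to $\mathbf{L}\mathbf{x}=\mathbf{b}$ with initial guess $\mathbf{x}^{(0)}=\mathbf{0}$. Then for every integer $n\ge 1$ there is a symmetric matrix $\mathbf{C}\in\mathbb{R}^{N\times N}$, independent of $\mathbf{b}$, such that $\mathbf{x}^{(n)}=\mathbf{C}\mathbf{b}$ for all $\mathbf{b}\in\mathbb{R}^N$.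
   Context: The set $D=\{1,\dots,N\}$ of unknowns is divided into potentially overlapping subdomains $D_1,\dots,D_m\subseteq D$, and $\mathbf{C}_i$ is the selection matrix from $D$ to $D_i$: the $0/1$ matrix of size $|D_i|\times N$ whose rows are the standard basis row vectors indexed by the elements of $D_i$. Put $\mathbf{K}_i=\mathbf{C}_i^T(\mathbf{C}_i\mathbf{L}\mathbf{C}_i^T)^{-1}\mathbf{C}_i$. The multiplicative Vanka operator that solves the local problems sequentially from $D_1$ to $D_m$ is $$\mathbf{S}_{MV}^{(1)}=\bigl[\mathbf{I}-(\mathbf{I}-\mathbf{K}_m\mathbf{L})\cdots(\mathbf{I}-\mathbf{K}_2\mathbf{L})(\mathbf{I}-\mathbf{K}_1\mathbf{L})\bigr]\mathbf{L}^{-1},$$ and the one that solves them in the reverse order, from $D_m$ to $D_1$, is $$\mathbf{S}_{MV}^{(2)}=\bigl[\mathbf{I}-(\mathbf{I}-\mathbf{K}_1\mathbf{L})(\mathbf{I}-\mathbf{K}_2\mathbf{L})\cdots(\mathbf{I}-\mathbf{K}_m\mathbf{L})\bigr]\mathbf{L}^{-1}.$$ One step of the symmetric multiplicative Vanka smoother is $$\mathbf{x}^{(k+\frac12)}=(\mathbf{I}-\mathbf{S}_{MV}^{(1)}\mathbf{L})\mathbf{x}^{(k)}+\mathbf{S}_{MV}^{(1)}\mathbf{b},\qquad \mathbf{x}^{(k+1)}=(\mathbf{I}-\mathbf{S}_{MV}^{(2)}\mathbf{L})\mathbf{x}^{(k+\frac12)}+\mathbf{S}_{MV}^{(2)}\mathbf{b}.$$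 *)

(* Defs.v *)
From mathcomp Require Import all_boot all_order all_algebra.
From mathcomp Require Import reals.

Set Implicit Arguments.
Unset Strict Implicit.
Unset Printing Implicit Defensive.

Import Order.TTheory GRing.Theory Num.Theory.
Local Open Scope ring_scope.

Section SymmetricMultiplicativeVanka.

Variables (R : realType) (N m : nat).
Implicit Types (L S : 'M[R]_N) (A : {set 'I_N}) (D : 'I_m -> {set 'I_N}).
Implicit Types (b x : 'cV[R]_N).

(* Rows are listed in increasing order of the elements of A. *)
Definition selection_mx A : 'M[R]_(#|A|, N) :=
  \matrix_(k, j) (enum_val k == j)%:R.

Definition local_mx L A : 'M[R]_#|A| :=
  selection_mx A *m L *m (selection_mx A)^T.

Definition vanka_correction L A : 'M[R]_N :=
  (selection_mx A)^T *m invmx (local_mx L A) *m selection_mx A.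

(* Subdomains are numbered from 0, and a big product lists its factors from
   left to right in increasing order of the index. The factor that acts first
   is the rightmost one, so the forward sweep, which treats the subdomains
   0, ..., m.-1 in this order, is the product over the reversed index. *)
Definition vanka_forward L D : 'M[R]_N :=
  (1%:M - \prod_(i < m)
      (1%:M - vanka_correction L (D (rev_ord i)) *m L)) *m invmx L.

Definition vanka_backward L D : 'M[R]_N :=
  (1%:M - \prod_(i < m)
      (1%:M - vanka_correction L (D i) *m L)) *m invmx L.

Definition smoothing_step S L b x : 'cV[R]_N :=
  (1%:M - S *m L) *m x + S *m b.

Definition sym_vanka_step L D b x : 'cV[R]_N :=
  smoothing_step (vanka_backward L D) L b
    (smoothing_step (vanka_forward L D) L b x).

Definition sym_vanka_iterate L D b (k : nat) : 'cV[R]_N :=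
  iter k (sym_vanka_step L D b) 0.

End SymmetricMultiplicativeVanka.

(* Main.v *)
(* Call B an L-adjoint of A when A^T L = L B.  Each local error propagator
   I - K_i L is its own L-adjoint because K_i and L are symmetric, and adjoints
   reverse products, so the backward sweep is the L-adjoint of the forward
   sweep and the error propagator E of one full step is L-self-adjoint.  The
   n-th iterate is (I - E^n) L^-1 b, and L-self-adjointness of E^n says exactly
   that E^n L^-1 is symmetric. *)
Require Import Defs.
From mathcomp Require Import all_boot all_order all_algebra.
From mathcomp Require Import reals.

Set Implicit Arguments.
Unset Strict Implicit.
Unset Printing Implicit Defensive.

Import Order.TTheory GRing.Theory Num.Theory.
Local Open Scope ring_scope.

Definition mxadjoint (R : comPzRingType) (N : nat) (L A B : 'M[R]_N) : Prop :=
  A^T *m L = L *m B.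

Section Adjoint.

Variables (R : comPzRingType) (N : nat) (L : 'M[R]_N).

Lemma mxadjoint1 : mxadjoint L 1 1.
Proof. by rewrite /mxadjoint trmx1 mul1mx mulmx1. Qed.

Lemma mxadjointM (A A' B B' : 'M[R]_N) :
  mxadjoint L A A' -> mxadjoint L B B' -> mxadjoint L (A * B) (B' * A').
Proof.
rewrite /mxadjoint => adjA adjB.
by rewrite trmx_mul -mulmxA adjA mulmxA adjB -mulmxA.
Qed.

Lemma mxadjointX (A B : 'M[R]_N) (n : nat) :
  mxadjoint L A B -> mxadjoint L (A ^+ n) (B ^+ n).
Proof.
move=> adjAB; elim: n => [|n IHn]; first exact: mxadjoint1.
by rewrite exprS exprSr; apply: mxadjointM.
Qed.

(** Induction on [m]: the last factor on the left is [A ord0] and the first on the right is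
    [B ord0], so splitting these off leaves the same claim for the families shifted by
    [lift ord0]. *)
Lemma mxadjoint_prod_rev (m : nat) (A B : 'I_m -> 'M[R]_N) :
  (forall i, mxadjoint L (A i) (B i)) ->
  mxadjoint L (\prod_(i < m) A (rev_ord i)) (\prod_(i < m) B i).
Proof.
elim: m A B => [|m IHm] A B adjAB; first by rewrite !big_ord0; exact: mxadjoint1.
rewrite big_ord_recr big_ord_recl /=.
have -> : rev_ord ord_max = ord0 :> 'I_m.+1 by apply/val_inj; rewrite /= subnn.
apply: mxadjointM => //.
under eq_bigr => i _.
  have -> : rev_ord (widen_ord (leqnSn m) i) = lift ord0 (rev_ord i).
    by apply/val_inj; rewrite /= /bump add1n subSS subnSK.
  over.
exact: (IHm (fun i => A (lift ord0 i))).
Qed.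

(** Both sides expand to L - L K L. *)
Lemma mxadjoint_sub_mulmx (K : 'M[R]_N) :
  L^T = L -> K^T = K -> mxadjoint L (1%:M - K *m L) (1%:M - K *m L).
Proof.
move=> L_sym K_sym; rewrite /mxadjoint linearB /= trmx1 trmx_mul L_sym K_sym.
by rewrite mulmxBl mulmxBr mul1mx mulmx1 mulmxA.
Qed.

End Adjoint.

(** L^-1 A^T = L^-1 (A^T L) L^-1 = L^-1 (L A) L^-1 = A L^-1. *)
Lemma mxadjoint_self_invmx_sym (R : comUnitRingType) (N : nat) (L A : 'M[R]_N) :
  L \in unitmx -> L^T = L -> mxadjoint L A A ->
  (A *m invmx L)^T = A *m invmx L.
Proof.
move=> L_unit L_sym adjA; rewrite trmx_mul trmx_inv L_sym.
by rewrite -[A^T](mulmxK L_unit) adjA !mulmxA mulVmx // mul1mx.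
Qed.

Section Vanka.

Variables (R : realType) (N : nat) (L : 'M[R]_N).

Lemma trmx_vanka_correction (A : {set 'I_N}) :
  L^T = L -> (vanka_correction L A)^T = vanka_correction L A.
Proof.
move=> L_sym; rewrite /vanka_correction /local_mx.
by rewrite !trmx_mul trmx_inv !trmx_mul !trmxK L_sym !mulmxA.
Qed.

(** Here S L = I - E, so a sweep multiplies the error relative to the exact solution L^-1 b by E. *)
Lemma smoothing_stepE (E : 'M[R]_N) (b x : 'cV[R]_N) :
  L \in unitmx ->
  smoothing_step ((1%:M - E) *m invmx L) L b x
    = E *m (x - invmx L *m b) + invmx L *m b.
Proof.
move=> L_unit; rewrite /smoothing_step mulmxKV // subKr -mulmxA.
by rewrite mulmxBl mul1mx mulmxBr addrA addrAC.
Qed.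

Lemma sym_vanka_iterateE (m : nat) (D : 'I_m -> {set 'I_N}) (b : 'cV[R]_N)
    (n : nat) :
  let P i := 1%:M - vanka_correction L (D i) *m L in
  let E := \prod_(i < m) P i * \prod_(i < m) P (rev_ord i) in
  L \in unitmx ->
  sym_vanka_iterate L D b n = (1%:M - E ^+ n) *m invmx L *m b.
Proof.
move=> P E L_unit; elim: n => [|n IHn].
  by rewrite /= expr0 subrr !mul0mx.
rewrite /sym_vanka_iterate iterS -/(sym_vanka_iterate L D b n) IHn.
rewrite /sym_vanka_step /vanka_forward /vanka_backward !smoothing_stepE //.
(* [addrK] cancels the exact solution between the two sweeps, so their error propagators compose; by
   [IHn] the error after [n] steps is - E^n L^-1 b. *)
rewrite addrK -!mulmxA !mulmxBl !mul1mx.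
by rewrite addrAC subrr add0r !mulmxN exprS -!mulmxA addrC.
Qed.

End Vanka.

Theorem theorem3 (R : realType) (N m : nat) (L : 'M[R]_N)
    (D : 'I_m -> {set 'I_N})
    (L_unit : L \in unitmx) (L_sym : L^T = L)
    (local_unit : forall i : 'I_m, local_mx L (D i) \in unitmx)
    (n : nat) (n_ge1 : (1 <= n)%N) :
  exists C : 'M[R]_N,
    C^T = C /\ forall b : 'cV[R]_N, sym_vanka_iterate L D b n = C *m b.
Proof.
pose P i := 1%:M - vanka_correction L (D i) *m L.
pose E := \prod_(i < m) P i * \prod_(i < m) P (rev_ord i).
exists ((1%:M - E ^+ n) *m invmx L); split; last first.
  by move=> b; exact: sym_vanka_iterateE.
have adjP i : mxadjoint L (P i) (P i).
  by apply: mxadjoint_sub_mulmx => //; exact: trmx_vanka_correction.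
have adjE : mxadjoint L E E.
  apply: mxadjointM; last exact: mxadjoint_prod_rev.
  (* The backward product must now stand on the left: reversing the reversed family gives back [P],
     since [rev_ord] is an involution. *)
  have := @mxadjoint_prod_rev _ _ L _ (fun i => P (rev_ord i))
    (fun i => P (rev_ord i)) (fun i => adjP (rev_ord i)).
  by under eq_bigr do rewrite rev_ordK.
rewrite mulmxBl mul1mx linearB /= trmx_inv L_sym.
by rewrite mxadjoint_self_invmx_sym //; exact: mxadjointX.
Qed.
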